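(* Let $(E,h^E)$ be a Hermitian holomorphic vector bundle of rank $r$ over a complex manifold $X$ of dimension $n$. Then $(E,h^E)$ is strongly decomposably positive of type II if and only if for every $x\in X$ there exist an integer $r_1$ with $0\le r_1\le r$, a unitary frame $\{e_i\}_{1\le i\le r}$ of $E_x$, some $N\in\mathbb{N}$, an $r\times N$ matrix $A$ of $(1,0)$-forms at $x$ and an $r\times N$ matrix $B$ of $(0,1)$-forms at $x$ such that, with respect to this frame, $$R^E_x=-B\wedge\overline{B}^\top+A\wedge\overline{A}^\top,$$ $$\mathrm{span}_{\mathbb{C}}\{\mathcal{A}\}\perp\mathrm{span}_{\mathbb{C}}\{\mathcal{B}\},$$ $$\mathrm{rank}(\mathbf{B})=r_1\cdot n,\qquad \mathrm{rank}(\mathbf{A})=(r-r_1)\cdot n.$$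
   Context: Curvature. $R^E$ is the Chern curvature of $(E,h^E)$. For a local holomorphic frame $\{e_i\}_{1\le i\le r}$ of $E$ and local holomorphic coordinates $\{z^\alpha\}_{1\le\alpha\le n}$, with $h_{i\bar j}=h^E(e_i,e_j)$, $\partial_\alpha=\partial/\partial z^\alpha$, $\partial_{\bar\beta}=\partial/\partial\bar z^\beta$, set $R_{i\bar j\alpha\bar\beta}=-\partial_\alpha\partial_{\bar\beta}h_{i\bar j}+h^{\bar l k}\partial_\alpha h_{i\bar l}\partial_{\bar\beta}h_{k\bar j}$. The curvature matrix is $R=(R^j_i)$ ($j$ row, $i$ column), where $R^E=R^j_i\,e_j\otimes e^i$, $R^j_i=R^j_{i\alpha\bar\beta}dz^\alpha\wedge d\bar z^\beta$ and $R_{i\bar j\alpha\bar\beta}=R^k_{i\alpha\bar\beta}h_{k\bar j}$; in a frame that is unitary at $x$, $R^j_{i\alpha\bar\beta}=R_{i\bar j\alpha\bar\beta}$ at $x$. The Einstein summation convention is used. Type II positivity. $(E,h^E)$ is strongly decomposably positive of type II if for every $x\in X$ there is an $h^E$-orthogonal decomposition $E_x=E_{1,x}\oplus E_{2,x}$ (either summand may be zero) with respect to which the Chern curvature is block diagonal, $$R^E_x=\begin{pmatrix}R^E_x|_{E_{1,x}}&0\\0&R^E_x|_{E_{2,x}}\end{pmatrix},$$ and such that $R_{i\bar j\alpha\bar\beta}u^{i\alpha}\overline{u^{j\beta}}>0$ for every non-zero $u=u^{i\alpha}e_i\otimes\partial_\alpha\in E_{1,x}\otimes T^{1,0}_xX$,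 and $R_{i\bar j\alpha\bar\beta}v^{i\bar\beta}\overline{v^{j\bar\alpha}}>0$ for every non-zero $v=v^{i\bar\beta}e_i\otimes\partial_{\bar\beta}\in E_{2,x}\otimes T^{0,1}_xX$. Matrices. For a matrix $M=(M_{ip})$ of one-forms, $M\wedge\overline M^\top$ has $(j,i)$ entry $\sum_pM_{jp}\wedge\overline{M_{ip}}$. Write $B_{ip}=\sum_{\alpha=1}^nB_{ip\bar\alpha}d\bar z^\alpha$ and $A_{ip}=\sum_{\alpha=1}^nA_{ip\alpha}dz^\alpha$ at $x$. Then $\mathbf{B}$ is the $N\times rn$ complex matrix with entry $B_{ip\bar\alpha}$ in row $p$, column $(i,\alpha)$; $\mathbf{A}$ is the $N\times rn$ complex matrix with entry $A_{ip\alpha}$ in row $p$, column $(i,\alpha)$. Moreover $$\{\mathcal{B}\}=\Big\{\sum_{i=1}^rB_{ip\bar\alpha}e_i:1\le p\le N,1\le\alpha\le n\Big\},\quad \{\mathcal{A}\}=\Big\{\sum_{i=1}^rA_{ip\alpha}e_i:1\le p\le N,1\le\alpha\le n\Big\}$$ are subsets of $E_x$, and $\perp$ denotes orthogonality with respect to $h^E$ in $E_x$. *)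

(* Defs.v *)
From HB Require Import structures.
From mathcomp Require Import all_boot all_order all_algebra.
From mathcomp Require Import all_classical all_reals all_analysis.
From mathcomp Require Import complex sesquilinear.

Set Implicit Arguments.
Unset Strict Implicit.
Unset Printing Implicit Defensive.

Import Order.TTheory GRing.Theory Num.Theory Num.Def.
Import numFieldNormedType.Exports.

Local Open Scope classical_set_scope.
Local Open Scope ring_scope.

(* R[i]^o is R[i] seen as a normed module over itself; writing C^n with these
   entries is what lets the topology and the C-normed structure be inferred. *)
Notation Cn R n := 'rV[R[i]^o]_n.

Section Calculus.
Variables (R : realType) (n : nat).
Local Notation C := R[i].
Implicit Types (f : Cn R n -> C) (O : set (Cn R n)) (v z : Cn R n).

Definition holomorphic_on (W : normedModType C) O (F : Cn R n -> W) :=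
  forall z, O z -> differentiable F z.

Definition re_along f v z : R -> R :=
  fun t => complex.Re (f (z + t%:C%C *: v)).
Definition im_along f v z : R -> R :=
  fun t => complex.Im (f (z + t%:C%C *: v)).

Definition rderivable f v z : Prop :=
  derivable (re_along f v z) 0 1 /\ derivable (im_along f v z) 0 1.
Definition rderive f v z : C :=
  (derive1 (re_along f v z) 0 +i* derive1 (im_along f v z) 0)%C.

Fixpoint Ck_on (k : nat) O f : Prop :=
  (forall z, O z -> {for z, continuous (f : Cn R n -> C^o)}) /\
  (if k is k'.+1 then
     forall v, (forall z, O z -> rderivable f v z) /\ Ck_on k' O (rderive f v)
   else True).

Definition smooth_on O f := forall k, Ck_on k O f.

(* d/dz^a = (d/dx^a - i d/dy^a) / 2 and d/dzbar^a = (d/dx^a + i d/dy^a) / 2 *)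
Definition dz_ (a : 'I_n) f : Cn R n -> C := fun z =>
  (rderive f (delta_mx 0 a) z - 'i%C * rderive f ('i%C *: delta_mx 0 a) z) / 2.
Definition dzbar_ (a : 'I_n) f : Cn R n -> C := fun z =>
  (rderive f (delta_mx 0 a) z + 'i%C * rderive f ('i%C *: delta_mx 0 a) z) / 2.

End Calculus.

Record chart (R : realType) (n : nat) (X : topologicalType) := Chart {
  cdom : set X ;
  cmap :> X -> Cn R n ;
  cinv : Cn R n -> X ;
  open_cdom : open cdom ;
  open_cimg : open (cmap @` cdom) ;
  cmapK : {in cdom, cancel cmap cinv} ;
  cmap_continuous : {within cdom, continuous cmap} ;
  cinv_continuous : {within cmap @` cdom, continuous cinv} }.

Definition compatible (R : realType) (n : nat) (X : topologicalType)
    (c d : chart R n X) : Prop :=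
  holomorphic_on (c @` (cdom c `&` cdom d)) (d \o cinv c) /\
  holomorphic_on (d @` (cdom c `&` cdom d)) (c \o cinv d).

Record complexManifold (R : realType) (n : nat) := ComplexManifold {
  carrier :> topologicalType ;
  atlas : set (chart R n carrier) ;
  carrier_hausdorff : hausdorff_space carrier ;
  carrier_second_countable : @second_countable carrier ;
  atlas_cover : forall x : carrier, exists2 c, atlas c & cdom c x ;
  atlas_compatible : forall c d, atlas c -> atlas d -> compatible c d }.

(* The given atlas need not be maximal: local holomorphic coordinates are all
   the charts compatible with it. *)
Definition holo_coordinates (R : realType) (n : nat) (X : complexManifold R n)
    (c : chart R n X) : Prop :=
  forall d, atlas d -> compatible c d.

Definition holomorphic_fun (R : realType) (n : nat) (X : complexManifold R n)
    (W : set X) (f : X -> R[i]) : Prop :=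
  forall c : chart R n X, atlas c ->
    holomorphic_on (c @` (W `&` cdom c)) ((f : X -> R[i]^o) \o cinv c).

(* The values of a frame outside fdom are irrelevant. *)
Record localFrame (R : realType) (X : topologicalType)
    (F : X -> vectType R[i]) (r : nat) := LocalFrame {
  fdom : set X ;
  fsec :> forall x, r.-tuple (F x) ;
  open_fdom : open fdom ;
  fsec_basis : forall x, fdom x -> basis_of fullv (fsec x) }.

(* s_j = \sum_i g_ij t_i with g_ij holomorphic; since g is pointwise
   invertible, its inverse is then holomorphic as well. *)
Definition holo_transition (R : realType) (n : nat) (X : complexManifold R n)
    (F : X -> vectType R[i]) (r : nat) (s t : localFrame F r) : Prop :=
  forall i j : 'I_r, holomorphic_fun (fdom s `&` fdom t)
    (fun x => coord (t x) i (tnth (s x) j)).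

(* A holomorphic vector bundle of rank r, given by its fibres and by a family
   of local trivialising frames with holomorphic transition matrices. *)
Record holoBundle (R : realType) (n : nat) (X : complexManifold R n) (r : nat)
  := HoloBundle {
  fiber :> X -> vectType R[i] ;
  frames : set (localFrame fiber r) ;
  frames_cover : forall x : X, exists2 s, frames s & fdom s x ;
  frames_compatible :
    forall s t, frames s -> frames t -> holo_transition s t }.

Definition holo_frame (R : realType) (n : nat) (X : complexManifold R n)
    (r : nat) (E : holoBundle X r) (s : localFrame E r) : Prop :=
  forall t, frames t -> holo_transition s t.

(* The matrix (h_{i jbar}) in the frame s, as a function of the coordinates. *)
Definition gram (R : realType) (n : nat) (X : complexManifold R n)
    (r : nat) (E : holoBundle X r) (h : forall x : X, {dot E x for conjC})
    (c : chart R n X) (s : localFrame E r) (z : Cn R n) : 'M[R[i]]_r :=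
  \matrix_(i, j) h (cinv c z) (tnth (s (cinv c z)) i) (tnth (s (cinv c z)) j).

(* {dot V for conjC} is the type of positive definite Hermitian forms on V,
   linear in the first argument and conjugate-linear in the second. *)
Record hermitianMetric (R : realType) (n : nat) (X : complexManifold R n)
    (r : nat) (E : holoBundle X r) := HermitianMetric {
  metric :> forall x : X, {dot E x for conjC} ;
  metric_smooth : forall (c : chart R n X) (s : localFrame E r),
    holo_coordinates c -> holo_frame s -> forall i j : 'I_r,
    smooth_on (c @` (fdom s `&` cdom c)) (fun z => gram metric c s z i j) }.

Section Curvature.
Variables (R : realType) (n r : nat) (X : complexManifold R n).
Variables (E : holoBundle X r) (h : hermitianMetric E).
Variables (c : chart R n X) (s : localFrame E r) (x : X).
Local Notation C := R[i].
Implicit Types (a b : 'I_n).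

Definition d_gram a : 'M[C]_r :=
  \matrix_(i, j) dz_ a (fun z => gram h c s z i j) (c x).
Definition dbar_gram b : 'M[C]_r :=
  \matrix_(i, j) dzbar_ b (fun z => gram h c s z i j) (c x).
Definition ddbar_gram a b : 'M[C]_r :=
  \matrix_(i, j) dz_ a (dzbar_ b (fun z => gram h c s z i j)) (c x).

(* R_{i jbar a bbar} at x is chern a b i j; h^{lbar k} is (invmx H) l k. *)
Definition chern a b : 'M[C]_r :=
  - ddbar_gram a b
  + d_gram a *m invmx (gram h c s (c x)) *m dbar_gram b.

(* R^k_{i a bbar} is chern_up a b i k, from R_{i jbar} = R^k_i h_{k jbar}. *)
Definition chern_up a b : 'M[C]_r := chern a b *m invmx (gram h c s (c x)).

(* The endomorphism R^E(d/dz^a, d/dzbar^b) of E_x. *)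
Definition chern_end a b (u : E x) : E x :=
  \sum_(i < r) \sum_(k < r)
    (coord (s x) i u * chern_up a b i k) *: tnth (s x) k.

End Curvature.

(* Components of u, v are taken in the frame s of E_x and in the frame d/dz^a
   (resp. d/dzbar^b) of T_x; hypotheses such as "each \sum_i u i a s_i is in E1"
   say that u is in E1 (x) T^{1,0}. The order on R[i] makes 0 < z mean that z is
   real and positive. *)
Definition typeII_decomposition (R : realType) (n r : nat)
    (X : complexManifold R n) (E : holoBundle X r) (h : hermitianMetric E)
    (c : chart R n X) (s : localFrame E r) (x : X)
    (E1 E2 : {vspace E x}) : Prop :=
  [/\ [/\ (E1 + E2 = fullv)%VS, directv (E1 + E2)
        & (E1 <= orthov (h x) E2)%VS],
      (forall a b u, u \in E1 -> chern_end h c s a b u \in E1),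
      (forall a b u, u \in E2 -> chern_end h c s a b u \in E2),
      (forall u : 'M[R[i]]_(r, n), u != 0 ->
        (forall a, \sum_(i < r) u i a *: tnth (s x) i \in E1) ->
        0 < \sum_(i < r) \sum_(j < r) \sum_(a < n) \sum_(b < n)
              chern h c s x a b i j * u i a * (u j b)^*)
    & (forall v : 'M[R[i]]_(r, n), v != 0 ->
        (forall b, \sum_(i < r) v i b *: tnth (s x) i \in E2) ->
        0 < \sum_(i < r) \sum_(j < r) \sum_(a < n) \sum_(b < n)
              chern h c s x a b i j * v i b * (v j a)^*)].

(* The curvature is a tensor, so that being a typeII_decomposition does not
   depend on the local coordinates c and the local holomorphic frame s used to
   compute it; c and s range over all possible choices. *)
Definition strongly_decomposably_positive_II (R : realType) (n r : nat)
    (X : complexManifold R n) (E : holoBundle X r) (h : hermitianMetric E) :=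
  forall (x : X) (c : chart R n X) (s : localFrame E r),
    holo_coordinates c -> cdom c x -> holo_frame s -> fdom s x ->
    exists E1 E2 : {vspace E x}, typeII_decomposition h c s E1 E2.

(* Complex-valued differential forms at a point, in fixed coordinates: forms
   are functions on the real tangent space, identified with C^n. *)
Section Forms.
Variables (R : realType) (n : nat).
Local Notation C := R[i].

Definition form1 := 'rV[C]_n -> C.
Definition form2 := 'rV[C]_n -> 'rV[C]_n -> C.

Definition dz (a : 'I_n) : form1 := fun v => v 0 a.
Definition conj_form (w : form1) : form1 := fun v => (w v)^*.
Definition dzbar (a : 'I_n) : form1 := conj_form (dz a).
Definition wedge (w e : form1) : form2 := fun u v => w u * e v - w v * e u.

(* A row k of coefficients stands for \sum_a k_a dz^a or \sum_a k_a dzbar^a;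
   accordingly a matrix of (1,0)- or (0,1)-forms is a matrix with entries in
   'rV[C]_n. *)
Definition form10 (k : 'rV[C]_n) : form1 := fun v => \sum_(a < n) k 0 a * dz a v.
Definition form01 (k : 'rV[C]_n) : form1 :=
  fun v => \sum_(a < n) k 0 a * dzbar a v.

(* The (j, i) entry of M /\ conj(M)^T. *)
Definition wedge_ctr (r N : nat) (M : 'I_r -> 'I_N -> form1) (j i : 'I_r) :
    form2 :=
  fun u v => \sum_(p < N) wedge (M j p) (conj_form (M i p)) u v.

(* Entry M_{ipa} in row p and column (i, a). *)
Definition coef_mx (r N : nat) (M : 'M['rV[C]_n]_(r, N)) : 'M[C]_(N, r * n) :=
  \matrix_(p < N) mxvec (\matrix_(i < r, a < n) M i p 0 a).

Definition coef_span (V : vectType C) (r N : nat) (e : r.-tuple V)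
    (M : 'M['rV[C]_n]_(r, N)) : {vspace V} :=
  <<[seq (\sum_(i < r) M i pa.1 0 pa.2 *: tnth e i)%R | pa : 'I_N * 'I_n]>>%VS.

End Forms.

Definition unitary_frame (R : realType) (V : vectType R[i])
    (g : {dot V for conjC}) (r : nat) (e : r.-tuple V) : Prop :=
  basis_of fullv e /\ orthonormal g e.

(* The (j, i) entry R^j_i of the curvature matrix in the frame e of E_x. *)
Definition curvature_form (R : realType) (n r : nat) (X : complexManifold R n)
    (E : holoBundle X r) (h : hermitianMetric E) (c : chart R n X)
    (s : localFrame E r) (x : X) (e : r.-tuple (E x)) (j i : 'I_r) :
    form2 R n :=
  fun u v => \sum_(a < n) \sum_(b < n)
    coord e j (chern_end h c s a b (tnth e i)) * wedge (dz a) (dzbar b) u v.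

(* Main.v *)
(* The curvature at x amounts to endomorphisms R_ab of E_x, hence to a
   sesquilinear form H(u, v) = sum_ab h(R_ab u_a, v_b) on E_x (x) T.  If it is
   positive on E1 (x) T then it is Hermitian there by polarisation (so the
   symmetry of second derivatives of h is never needed), and by the spectral
   theorem its compression to E1 (x) T is a Gram form D^* D, where the rows of D
   span E1 (x) T; these rows are the coefficients of B.
   The same applied to R_ba on E2 gives A.  Conversely, E2 := span A and its
   orthogonal complement E1 are preserved by R; on E1 (x) T only the B-part of H
   survives, and it is definite because rank B = n dim E1 forces the rows of B
   to span E1 (x) T. *)

Require Import Defs.
From HB Require Import structures.
From mathcomp Require Import all_boot all_order all_algebra.
From mathcomp Require Import all_classical all_reals all_analysis.
From mathcomp Require Import complex sesquilinear.
From mathcomp Require Import spectral ring zify.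

Set Implicit Arguments.
Unset Strict Implicit.
Unset Printing Implicit Defensive.

Import Order.TTheory GRing.Theory Num.Theory Num.Def.
Import numFieldNormedType.Exports.
Local Open Scope ring_scope.

Local Notation "M ^t*" := (M ^T ^ conjC)%sesqui (at level 30).

(** * Gram factorisations of positive semidefinite matrices *)

Section PsdMatrices.
Variable C : numClosedFieldType.

Definition sqform m (H : 'M[C]_m) (u : 'rV[C]_m) : C := (u *m H *m u^t*) 0 0.

Lemma trmxC_mul m n p (A : 'M[C]_(m, n)) (B : 'M[C]_(n, p)) :
  (A *m B)^t* = B^t* *m A^t*.
Proof. by rewrite trmx_mul map_mxM. Qed.

Lemma trmxCD m n (A B : 'M[C]_(m, n)) : (A + B)^t* = A^t* + B^t*.
Proof. by rewrite linearD map_mxD. Qed.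

Lemma trmxCN m n (A : 'M[C]_(m, n)) : (- A)^t* = - A^t*.
Proof. by rewrite linearN map_mxN. Qed.

Lemma sqform_congr k m (D : 'M[C]_(k, m)) (u : 'rV[C]_m) :
  sqform (D^t* *m D) u = dotmx (u *m D^t*) (u *m D^t*).
Proof. by rewrite dotmxE /sqform trmxC_mul trmxCK !mulmxA. Qed.

(** The value of the form at a basis vector is the squared norm of a row of the adjoint of [D]. *)
Lemma trmxC_mul_eq0 k m (D : 'M[C]_(k, m)) : D^t* *m D = 0 -> D = 0.
Proof.
move=> D0; rewrite -[D]trmxCK; suff -> : D^t* = 0 by rewrite trmx0 map_mx0.
apply/row_matrixP => i; rewrite rowE row0; apply/eqP.
rewrite -(dnorm_eq0 (@dotmx C k)) -[X in X == _]sqform_congr D0.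
by rewrite /sqform mulmx0 mul0mx mxE.
Qed.

Lemma sqform_delta2 m (H : 'M[C]_m) i j c :
  sqform H (delta_mx 0 i + c *: delta_mx 0 j)
  = H i i + c^* * H i j + c * H j i + c * c^* * H j j.
Proof.
rewrite /sqform linearD linearZ /= !trmx_delta map_mxD map_mxZ !map_delta_mx.
rewrite !mulmxDl !mulmxDr -!scalemxAl -!scalemxAr -!rowE -!colE.
by rewrite !mxE [c * (c^* * _)]mulrA; ring.
Qed.

(* Polarisation along e_i + e_j and e_i + 'i e_j. *)
Lemma sqform_real_herm m (H : 'M[C]_m) :
  (forall u, sqform H u \is Num.real) -> H^t* = H.
Proof.
move=> Hreal; have diag i : H i i \is Num.real.
  have := Hreal (delta_mx 0 i); rewrite /sqform trmx_delta map_delta_mx.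
  by rewrite -rowE -colE !mxE.
apply/matrixP => i j; rewrite !mxE.
have cross c : c^* * H i j + c * H j i \is Num.real.
  have := Hreal (delta_mx 0 i + c *: delta_mx 0 j); rewrite sqform_delta2.
  rewrite (_ : _ + _ + _ + _ = (c^* * H i j + c * H j i)
     + (H i i + c * c^* * H j j)); last by ring.
  rewrite rpredDr // rpredD // rpredM // -normCK rpredX //; exact: normr_real.
have /CrealP := cross 1; rewrite conjC1 !mul1r rmorphD /= => e1.
have /CrealP := cross 'i;
rewrite conjCi rmorphD !rmorphM /= rmorphN /= conjCi opprK.
move=> e2; have {}e2 : (H i j)^* - (H j i)^* = H j i - H i j.
  apply: (mulfI (neq0Ci C)); rewrite !mulrBr -mulNr e2; ring.
apply/(mulfI (_ : 2%:R != 0 :> C)); first by rewrite pnatr_eq0.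
transitivity (((H i j)^* + (H j i)^* ) - ((H i j)^* - (H j i)^* )).
  by ring.
by rewrite e1 e2; ring.
Qed.

(** Spectral theorem: [H] is conjugate to a diagonal matrix by a unitary [U]. The eigenvalues are
    the values of the form at the rows of [U], hence nonnegative, and their square roots scale these
    rows to give [D]. *)
Lemma psd_factor m (H : 'M[C]_m) :
  (forall u, 0 <= sqform H u) -> exists D : 'M[C]_m, H = D^t* *m D.
Proof.
move=> Hge0; have Hherm : H^t* = H.
  by apply: sqform_real_herm => u; apply: ger0_real.
have Hn : H \is normalmx by apply/normalmxP; rewrite Hherm.
have /orthomx_spectralP := Hn.
set U := spectralmx H; set d := spectral_diag H => HE.
have UU : U \is unitarymx by apply: spectral_unitarymx.
have iU : invmx U = U^t* by rewrite invmx_unitary.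
have Uu : U *m U^t* = 1%:M by apply/unitarymxP.
have d_ge0 i : 0 <= d 0 i.
  have := Hge0 (row i U); rewrite HE iU /sqform !mulmxA rowE.
  rewrite -(mulmxA (delta_mx 0 i)) Uu mulmx1 -!mulmxA trmxC_mul mulmxA.
  rewrite (mulmxA U) Uu mul1mx trmx_delta map_delta_mx -rowE -colE !mxE eqxx.
  by rewrite mulr1n.
exists (diag_mx (\row_i sqrtC (d 0 i)) *m U).
rewrite {1}HE iU trmxC_mul !mulmxA; congr (_ *m _).
rewrite -mulmxA; congr (_ *m _); rewrite tr_diag_mx map_diag_mx mulmx_diag.
congr diag_mx; apply/rowP => i; rewrite !mxE.
by rewrite /= (CrealP _) ?ger0_real ?sqrtC_ge0 // -expr2 sqrtCK.
Qed.

Section Projection.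
Variables (m : nat) (Pi H : 'M[C]_m).
Hypotheses (PiPi : Pi *m Pi = Pi) (PiC : Pi^t* = Pi) (PiH : Pi *m H = H *m Pi).

Lemma sqform_proj u : sqform (Pi *m H) u = sqform H (u *m Pi).
Proof.
rewrite /sqform trmxC_mul PiC !mulmxA -(mulmxA (u *m Pi) H Pi) -PiH mulmxA.
by rewrite -(mulmxA u Pi Pi) PiPi.
Qed.

(* D kills exactly ker Pi: if w D^* = 0 then H vanishes at w Pi, so w Pi = 0. *)
Lemma psd_factor_proj :
  (forall u : 'rV_m, u != 0 -> u *m Pi = u -> 0 < sqform H u) ->
  exists D : 'M[C]_m,
    [/\ Pi *m H = D^t* *m D, D *m Pi = D & \rank D = \rank Pi].
Proof.
move=> Hpos; have sq_gt0 u : u *m Pi != 0 -> 0 < sqform (Pi *m H) u.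
  by move=> uP0; rewrite sqform_proj Hpos // -mulmxA PiPi.
have [u|D DE] := @psd_factor _ (Pi *m H).
  have [uP0|/sq_gt0/ltW//] := eqVneq (u *m Pi) 0.
  by rewrite sqform_proj uP0 /sqform !mul0mx mxE.
(* With Q = 1 - Pi, the Gram matrix of D Q is Q (Pi H) Q, which vanishes because Q Pi = 0. *)
have DPi : D *m Pi = D.
  apply/eqP; rewrite eq_sym -subr_eq0; apply/eqP/trmxC_mul_eq0.
  rewrite -{1 3}[D]mulmx1 -!mulmxBr trmxC_mul -mulmxA (mulmxA _ D) -DE.
  rewrite trmxCD trmxCN PiC trmx1 map_mx1 !mulmxA mulmxBl mul1mx PiPi.
  by rewrite subrr !mul0mx.
exists D; split=> //; apply/eqP; rewrite eqn_leq; apply/andP; split.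
  by rewrite -DPi mxrankS // submxMl.
have kerS : (kermx (D^t*) <= kermx Pi)%MS.
  apply/rV_subP => w /sub_kermxP wD; apply/sub_kermxP/eqP.
  apply: contraT => /sq_gt0; rewrite DE sqform_congr wD linear0l ltxx //.
have := mxrankS kerS; rewrite !mxrank_ker mxrank_map mxrank_tr.
by move: (rank_leq_row Pi) (rank_leq_row D); lia.
Qed.

(** Converse of [psd_factor_proj]. Equality of ranks makes the row space of [D] equal to that of
    [Pi], so [u] is a combination of rows of [D]; if [u] were orthogonal to all these rows, it would
    be orthogonal to itself. *)
Lemma sqform_factor_gt0 k (D : 'M[C]_(k, m)) (u : 'rV_m) :
  Pi *m H = D^t* *m D -> D *m Pi = D -> \rank D = \rank Pi ->
  u != 0 -> u *m Pi = u -> 0 < sqform H u.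
Proof.
move=> DE DPi rD u0 uPi; 
rewrite -[u in sqform _ u]uPi -sqform_proj DE sqform_congr.
rewrite dnorm_gt0; apply: contraNneq u0 => uD.
have : (Pi <= D)%MS.
  have sDP : (D <= Pi)%MS by rewrite -DPi submxMl.
  by rewrite -(geq_leqif (mxrank_leqif_sup sDP)) rD.
rewrite -(dnorm_eq0 (@dotmx C m)) => sPD.
have /submxP[x ux] : (u <= D)%MS by rewrite -uPi (submx_trans _ sPD) // submxMl.
by rewrite /= dotmxE [in u^t*]ux trmxC_mul mulmxA uD mul0mx mxE.
Qed.

End Projection.

(** * Left multiplication on flattened matrices *)

Lemma mxvec_mul_lin_mulmx k r n (A : 'M[C]_(k, r)) (u : 'M[C]_(r, n)) :
  mxvec u *m lin_mulmx A = mxvec (A *m u).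
Proof. exact: mul_vec_lin. Qed.

(** The order is reversed because flattened matrices are row vectors, acted on from the right. *)
Lemma lin_mulmx_mul k r l n (A : 'M[C]_(k, r)) (B : 'M[C]_(r, l)) :
  lin_mulmx B *m lin_mulmx A = lin_mulmx (A *m B) :> 'M[C]_(l * n, k * n).
Proof.
apply/row_matrixP => i; rewrite !rowE mulmxA.
by rewrite -[delta_mx 0 i]vec_mxK !mxvec_mul_lin_mulmx mulmxA.
Qed.

Lemma lin_mulmx1 r n : lin_mulmx 1%:M = 1%:M :> 'M[C]_(r * n).
Proof.
apply/row_matrixP => i; rewrite !rowE.
by rewrite -[delta_mx 0 i]vec_mxK !mxvec_mul_lin_mulmx mul1mx mulmx1.
Qed.

Lemma lin_mulmxE k r n (A : 'M[C]_(k, r)) i j (a b : 'I_n) :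
  lin_mulmx A (mxvec_index i a) (mxvec_index j b) = A j i * (a == b)%:R.
Proof.
pose d : 'rV[C]_(r * n) := delta_mx 0 (mxvec_index i a).
transitivity ((d *m lin_mulmx A) 0 (mxvec_index j b)).
  by rewrite -rowE [RHS]mxE.
rewrite /d -mxvec_delta mxvec_mul_lin_mulmx mxvecE mxE (bigD1 i) //=.
rewrite mxE eqxx /=.
rewrite big1 ?addr0 1?eq_sym // => l /negPf li; by rewrite mxE li /= mulr0.
Qed.

(** In the full-rank factorisation of [P], the one-sided inverses of the two factors are carried by
    [lin_mulmx] to one-sided inverses, so the rank is the inner dimension. *)
Lemma rank_lin_mulmx r n (P : 'M[C]_r) :
  \rank (lin_mulmx P : 'M[C]_(r * n)) = (\rank P * n)%N.
Proof.
rewrite -{1}(mulmx_base P) -lin_mulmx_mul.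
have /row_freeP[X RX] := row_base_free P.
have /row_fullP[Y YC] := col_base_full P.
rewrite mxrankMfree; last first.
  by apply/row_freeP; exists (lin_mulmx Y); rewrite lin_mulmx_mul YC lin_mulmx1.
apply/eqP; rewrite -[_ == _]/(row_full _); apply/row_fullP.
by exists (lin_mulmx X); rewrite lin_mulmx_mul RX lin_mulmx1.
Qed.

End PsdMatrices.

(** * Sesquilinear forms on the tensor product of E and T, as matrices indexed by pairs *)

Section TensorBlocks.
Variables (C : numClosedFieldType) (r n : nat).
Implicit Types (P : 'M[C]_r) (K : 'I_n -> 'I_n -> 'M[C]_r).

Lemma sum_mxvec_index (V : nmodType) (F : 'I_(r * n) -> V) :
  \sum_k F k = \sum_i \sum_a F (mxvec_index i a).
Proof.
rewrite pair_bigA (reindex _ (curry_mxvec_bij _ _)) /=.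
by apply: eq_bigr => -[].
Qed.

(* Row (i, a), column (j, b); [mxvec] is used to decode the flat indices. *)
Definition tensor_mx K : 'M[C]_(r * n) :=
  \matrix_(k, l)
    mxvec (\matrix_(i, a) mxvec (\matrix_(j, b) K a b i j) 0 l) 0 k.

Lemma tensor_mxE K i a j b :
  tensor_mx K (mxvec_index i a) (mxvec_index j b) = K a b i j.
Proof. by rewrite mxE mxvecE mxE mxvecE mxE. Qed.

Lemma matrix_indexP (M M' : 'M[C]_(r * n)) :
  (forall i a j b, M (mxvec_index i a) (mxvec_index j b)
     = M' (mxvec_index i a) (mxvec_index j b)) -> M = M'.
Proof.
by move=> eqM; apply/matrixP => k l; case/mxvec_indexP: k; case/mxvec_indexP: l.
Qed.

(** The transpose compensates for the row-vector convention: [lin_mulmx P^T] is the Kronecker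
    product of [P] with the identity, so it acts on each block [K a b] separately. *)
Lemma mul_lin_mulmx_tensor P K :
  lin_mulmx P^T *m tensor_mx K = tensor_mx (fun a b => P *m K a b).
Proof.
apply: matrix_indexP => i a j b; rewrite tensor_mxE !mxE sum_mxvec_index.
apply: eq_bigr => k _; rewrite (bigD1 a) //= big1 => [|c ca].
  by rewrite lin_mulmxE tensor_mxE mxE eqxx mulr1 addr0.
by rewrite lin_mulmxE eq_sym (negPf ca) mulr0 mul0r.
Qed.

Lemma mul_tensor_lin_mulmx P K :
  tensor_mx K *m lin_mulmx P^T = tensor_mx (fun a b => K a b *m P).
Proof.
apply: matrix_indexP => i a j b; rewrite tensor_mxE !mxE sum_mxvec_index.
apply: eq_bigr => k _; rewrite (bigD1 b) //= big1 => [|c cb].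
  by rewrite lin_mulmxE tensor_mxE mxE eqxx mulr1 addr0.
by rewrite lin_mulmxE (negPf cb) !mulr0.
Qed.

Lemma trmxC_lin_mulmx P :
  P^t* = P -> (lin_mulmx P^T)^t* = lin_mulmx P^T :> 'M[C]_(r * n).
Proof.
move=> PC; apply: matrix_indexP => i a j b.
rewrite [LHS]mxE [X in conjC X]mxE !lin_mulmxE -{2}PC !mxE rmorphM /=.
by rewrite conjC_nat eq_sym.
Qed.

Lemma sqform_tensor K (u : 'M[C]_(r, n)) :
  sqform (tensor_mx K) (mxvec u) =
  \sum_i \sum_j \sum_a \sum_b K a b i j * u i a * (u j b)^*.
Proof.
rewrite /sqform mxE sum_mxvec_index exchange_big /=.
rewrite (eq_bigr (fun b => \sum_i \sum_j \sum_a
   K a b i j * u i a * (u j b)^*)) => [|b _]; last first.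
  rewrite exchange_big; apply: eq_bigr => j _; rewrite mxE sum_mxvec_index.
  rewrite mulr_suml; apply: eq_bigr => i _; rewrite mulr_suml.
  by apply: eq_bigr => a _; rewrite tensor_mxE !mxE !mxvecE; ring.
rewrite exchange_big; apply: eq_bigr => i _.
rewrite exchange_big; apply: eq_bigr => j _.
by rewrite exchange_big.
Qed.

End TensorBlocks.

(** * Orthogonal decompositions in a unitary basis *)

Lemma coord_sum_basis (K : fieldType) (V : vectType K) r (s : r.-tuple V)
    (k : 'I_r -> K) i : basis_of fullv s ->
  coord s i (\sum_j k j *: tnth s j) = k i.
Proof.
move=> s_basis; under eq_bigr do rewrite (tnth_nth 0).
by rewrite coord_sum_free ?(basis_free s_basis).
Qed.

Section Unitary.
Variables (C : numClosedFieldType) (V : vectType C) (g : {dot V for conjC}).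
Variables (r : nat) (e : r.-tuple V).
Hypothesis (e_basis : basis_of fullv e).
Hypothesis (e_on : forall i j, g (tnth e i) (tnth e j) = (i == j)%:R).

Definition crd (v : V) : 'rV[C]_r := \row_i g v (tnth e i).
Definition vec (u : 'rV[C]_r) : V := \sum_i u 0 i *: tnth e i.

Lemma vecK : cancel vec crd.
Proof.
move=> u; apply/rowP => j; rewrite mxE linear_sumlz (bigD1 j) //=.
rewrite linearZl_LR /= e_on eqxx mulr1 big1 ?addr0 // => i ij.
by rewrite linearZl_LR /= e_on (negPf ij) mulr0.
Qed.

Lemma crdK : cancel crd vec.
Proof.
move=> v; have vE : v = vec (\row_i coord e i v).
  rewrite [LHS](coord_basis e_basis) ?memvf //.
  by apply: eq_bigr => i _; rewrite mxE -tnth_nth.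
by rewrite {1}vE vecK -vE.
Qed.

Lemma coord_unitary i v : coord e i v = g v (tnth e i).
Proof.
by rewrite -{1}(crdK v) /vec coord_sum_basis // mxE.
Qed.

Lemma crdD u v : crd (u + v) = crd u + crd v.
Proof. by apply/rowP => i; rewrite !mxE linearDl. Qed.

Lemma crd_inj : injective crd. Proof. exact: can_inj crdK. Qed.

Lemma crd_tnth i : crd (tnth e i) = delta_mx 0 i.
Proof. by apply/rowP => j; rewrite !mxE e_on eqxx eq_sym. Qed.

(** Row convention: row [i] holds the coordinates of the image of the i-th basis vector, so that
    coordinate rows are multiplied on the right. Applied to the curvature, entry (i, j) is R^j_i. *)
Definition mxend (T : 'End(V)) : 'M[C]_r :=
  \matrix_(i, j) g (T (tnth e i)) (tnth e j).

Lemma crd_mxend (T : 'End(V)) v : crd (T v) = crd v *m mxend T.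
Proof.
apply/rowP => j; rewrite !mxE -{1}(crdK v) linear_sum linear_sumlz /=.
by apply: eq_bigr => i _; rewrite linearZ linearZl_LR /= !mxE.
Qed.

(** [P] is the matrix of the orthogonal projection onto [E], which is described as its set of fixed
    points. *)
Definition orthoproj (P : 'M[C]_r) (E : {vspace V}) : Prop :=
  [/\ P *m P = P, P^t* = P & forall v, (v \in E) = (crd v *m P == crd v)].

Lemma orthoproj_exists (E1 E2 : {vspace V}) :
  (E1 + E2 = fullv)%VS -> directv (E1 + E2) -> (E1 <= orthov g E2)%VS ->
  exists P, orthoproj P E1 /\ orthoproj (1%:M - P) E2.
Proof.
move=> sE /directv_addP dE oE.
have dE' : (E2 :&: E1 = 0)%VS by rewrite capvC.
pose p := daddv_pi E1 E2; pose q := daddv_pi E2 E1.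
have pq v : p v + q v = v by rewrite daddv_pi_add // sE memvf.
have pq0 u v : g (p u) (q v) = 0 by apply: (orthovP oE); apply: memv_pi.
have qp0 u v : g (q u) (p v) = 0.
  by apply/eqP; rewrite herm_eq0C; apply/eqP; apply: pq0.
pose P := mxend p.
have Pv v : crd v *m P = crd (p v) by rewrite crd_mxend.
have Qv v : crd v *m (1%:M - P) = crd (q v).
  by rewrite mulmxBr mulmx1 Pv -{1}(pq v) crdD addrC addKr.
have PP : P *m P = P.
  apply/row_matrixP => i; rewrite !rowE mulmxA -crd_tnth !Pv.
  by rewrite /p daddv_pi_proj.
(* By orthogonality of the summands, both entries reduce to the inner product of the projections of
   the two basis vectors. *)
have PC : P^t* = P.
  apply/matrixP => i j; rewrite !mxE.
  rewrite -[tnth e i in LHS]pq -[tnth e j in RHS]pq linearDr linearDr /=.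
  rewrite pq0 pq0 !addr0 [RHS]hermC /= expr0 mul1r //.
exists P; split; split=> //.
- move=> v; rewrite Pv (inj_eq crd_inj); apply/idP/eqP => [|<-].
    by apply: daddv_pi_id.
  exact: memv_pi.
- by rewrite mulmxBr mulmxBl mul1mx mulmx1 mulmxBl mul1mx PP subrr subr0.
- by rewrite trmxCD trmxCN PC trmx1 map_mx1.
- move=> v; rewrite Qv (inj_eq crd_inj); apply/idP/eqP => [|<-].
    by apply: daddv_pi_id.
  exact: memv_pi.
Qed.

Lemma orthoproj_mem P E u : orthoproj P E -> u *m P = u -> vec u \in E.
Proof. by case=> _ _ ->; rewrite vecK => ->. Qed.

(** Write M for [mxend T]. Invariance of [E1] gives P M P = P M, and invariance of [E2] gives (1 -
    P) M P = 0, that is M P = P M P. *)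
Lemma orthoproj_comm P E1 E2 (T : 'End(V)) :
  orthoproj P E1 -> orthoproj (1%:M - P) E2 ->
  (forall u, u \in E1 -> T u \in E1) -> (forall u, u \in E2 -> T u \in E2) ->
  P *m mxend T = mxend T *m P.
Proof.
move=> oP oQ T1 T2; have [PP _ mP] := oP; have [QQ _ mQ] := oQ.
have e1 : P *m mxend T *m P = P *m mxend T.
  apply/row_matrixP => i; rewrite !rowE !mulmxA; set u := delta_mx _ _ *m P.
  have uE : vec u \in E1 by apply: (orthoproj_mem oP); rewrite -mulmxA PP.
  by have := T1 _ uE; rewrite mP crd_mxend vecK => /eqP.
have e2 : (1%:M - P) *m mxend T *m (1%:M - P) = (1%:M - P) *m mxend T.
  apply/row_matrixP => i; rewrite !rowE !mulmxA.
  set u := delta_mx _ _ *m (_ - _).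
  have uE : vec u \in E2 by apply: (orthoproj_mem oQ); rewrite -mulmxA QQ.
  by have := T2 _ uE; rewrite mQ crd_mxend vecK => /eqP.
move: e2; rewrite mulmxBr mulmx1 => /(canRL (subKr _)).
rewrite subrr => /eqP; rewrite mulmxBl mul1mx mulmxBl e1 subr_eq0 => /eqP <-.
by [].
Qed.

(** * Positivity on the tensor product and Gram factors *)

Section Curvature.
Variable (n : nat).
Implicit Types (T : 'I_n -> 'I_n -> 'End(V)).

(** A family [w] stands for the tensor summing the [w a] (x) d_a. No basis of [V] occurs, so
    positivity can be passed from a holomorphic frame to a unitary one. *)
Definition positive_on T (E : {vspace V}) :=
  forall w : 'I_n -> V, (exists a, w a != 0) -> (forall a, w a \in E) ->
  0 < \sum_a \sum_b g (T a b (w a)) (w b).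

Lemma sum_dot_basis T (t : r.-tuple V) (u : 'M[C]_(r, n)) :
  \sum_a \sum_b g (T a b (\sum_i u i a *: tnth t i))
                  (\sum_i u i b *: tnth t i)
  = \sum_i \sum_j \sum_a \sum_b
      g (T a b (tnth t i)) (tnth t j) * u i a * (u j b)^*.
Proof.
rewrite (eq_bigr (fun a => \sum_b \sum_i \sum_j
      g (T a b (tnth t i)) (tnth t j) * u i a * (u j b)^*)) => [|a _].
  rewrite (eq_bigr _ (fun a _ => exchange_big _ _ _ _ _ _)) exchange_big /=.
  apply: eq_bigr => i _.
  rewrite (eq_bigr _ (fun a _ => exchange_big _ _ _ _ _ _)) exchange_big /=.
  by [].
apply: eq_bigr => b _; rewrite (linear_sum (T a b)) linear_sumlz /=.
apply: eq_bigr => i _; rewrite [T a b _]linearZ linearZl_LR /=.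
rewrite linear_sumr mulr_sumr.
by apply: eq_bigr => j _; rewrite linearZr_LR /=; ring.
Qed.

(** Any basis [t] will do: it is used with the holomorphic frame for the definition of type II
    positivity and with the unitary frame for the factorisations. *)
Lemma positive_onP T E (t : r.-tuple V) : basis_of fullv t ->
  positive_on T E <->
  (forall u : 'M[C]_(r, n), u != 0 ->
    (forall a, \sum_i u i a *: tnth t i \in E) ->
    0 < \sum_i \sum_j \sum_a \sum_b
      g (T a b (tnth t i)) (tnth t j) * u i a * (u j b)^*).
Proof.
move=> t_basis; split=> [Tpos u u0 uE|Tpos w [a0 w0] wE].
  rewrite -sum_dot_basis; apply: Tpos => //; apply/existsP.
  apply: contraNT u0; rewrite negb_exists => /forallP u0.
  apply/eqP/matrixP => i a; rewrite mxE.
  have /negPn/eqP/(congr1 (coord t i)) := u0 a.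
  by rewrite coord_sum_basis // linear0.
pose u := \matrix_(i < r, a < n) coord t i (w a).
have uw a : \sum_i u i a *: tnth t i = w a.
  rewrite [RHS](coord_basis t_basis) ?memvf //.
  by apply: eq_bigr => i _; rewrite mxE -tnth_nth.
have := Tpos u; rewrite -sum_dot_basis.
rewrite (eq_bigr (fun a => \sum_b g (T a b (w a)) (w b))) => [|a _]; last first.
  by apply: eq_bigr => b _; rewrite !uw.
apply=> [|a]; last by rewrite uw.
apply: contraNneq w0 => u0; rewrite -uw u0 big1 // => i _.
by rewrite mxE scale0r.
Qed.

(** The members of the families whose spans are the A- and B-spans, read off the flat coefficient
    matrix. *)
Definition coef_vec N (D : 'M[C]_(N, r * n)) p a : V :=
  \sum_i D p (mxvec_index i a) *: tnth e i.

Lemma crd_coef_vec N (D : 'M[C]_(N, r * n)) p a i :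
  crd (coef_vec D p a) 0 i = D p (mxvec_index i a).
Proof.
rewrite (_ : coef_vec D p a = vec (\row_i D p (mxvec_index i a))).
  by rewrite vecK mxE.
by apply: eq_bigr => j _; rewrite mxE.
Qed.

Lemma coef_vec_mem P E N (D : 'M[C]_(N, r * n)) : orthoproj P E ->
  (forall p a, coef_vec D p a \in E) <-> D *m lin_mulmx P^T = D.
Proof.
case=> _ _ mP.
have DP p j b : (D *m lin_mulmx P^T) p (mxvec_index j b)
   = (crd (coef_vec D p b) *m P) 0 j.
  rewrite !mxE sum_mxvec_index; apply: eq_bigr => i _.
  rewrite (bigD1 b) //= big1 => [|a ab].
    by rewrite lin_mulmxE mxE eqxx mulr1 addr0 crd_coef_vec.
  by rewrite lin_mulmxE (negPf ab) !mulr0.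
split=> [DE|DE p a].
  apply/matrixP => p k; case/mxvec_indexP: k => j b.
  by move: (DE p b); rewrite DP mP => /eqP ->; rewrite crd_coef_vec.
rewrite mP; apply/eqP/rowP => j.
by rewrite -DP DE crd_coef_vec.
Qed.

(* [lin_mulmx P^T] is the projection P (x) 1 of E (x) T onto E1 (x) T. *)
Lemma orthoproj_lin P E : orthoproj P E ->
  let Pi : 'M[C]_(r * n) := lin_mulmx P^T in
  [/\ Pi *m Pi = Pi, Pi^t* = Pi & \rank Pi = (\rank P * n)%N].
Proof.
case=> PP PC _; split; first by rewrite lin_mulmx_mul -trmx_mul PP.
- exact: trmxC_lin_mulmx.
- by rewrite rank_lin_mulmx mxrank_tr.
Qed.

(** This is [psd_factor_proj] for the flattened form and the projection P (x) 1; the relation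
    between [D] and the projection says that the coefficient vectors lie in [E]. *)
Lemma positive_factor T P E : orthoproj P E ->
  (forall a b, P *m mxend (T a b) = mxend (T a b) *m P) ->
  positive_on T E ->
  exists D : 'M[C]_(r * n),
    [/\ forall a b i j, (P *m mxend (T a b)) i j
          = \sum_p (D p (mxvec_index i a))^* * D p (mxvec_index j b),
        forall p a, coef_vec D p a \in E
      & \rank D = (\rank P * n)%N].
Proof.
move=> oP cP /(positive_onP _ _ e_basis) Tpos.
have [PP PC rP] := orthoproj_lin oP.
pose K a b := mxend (T a b).
have [||D [DE DP rD]] := @psd_factor_proj _ _ _ (tensor_mx K) PP PC.
- rewrite mul_lin_mulmx_tensor mul_tensor_lin_mulmx.
  by apply: matrix_indexP => i a j b; rewrite !tensor_mxE /K cP.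
- move=> w w0 wP; rewrite -[w]vec_mxK sqform_tensor.
  rewrite [X in 0 < X](eq_bigr (fun i => \sum_j \sum_a \sum_b
     g (T a b (tnth e i)) (tnth e j) * vec_mx w i a * (vec_mx w j b)^*)).
    apply: Tpos; first by rewrite -(inj_eq (can_inj mxvecK)) vec_mxK linear0.
    move=> a; have := (@coef_vec_mem P E 1 w oP).2 wP 0 a; rewrite /coef_vec.
    by under eq_bigr do rewrite -{1}[w]vec_mxK mxvecE.
  move=> i _; apply: eq_bigr => j _; apply: eq_bigr => a _.
  by apply: eq_bigr => b _; rewrite mxE.
exists D; split; last by rewrite rD.
  move=> a b i j; 
  have /matrixP/(_ (mxvec_index i a) (mxvec_index j b)) := DE.
  rewrite mul_lin_mulmx_tensor tensor_mxE => ->; rewrite mxE.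
  by apply: eq_bigr => p _; rewrite !mxE.
exact/(coef_vec_mem D oP).
Qed.

Lemma factor_positive T P E N (D : 'M[C]_(N, r * n)) : orthoproj P E ->
  (forall a b, P *m mxend (T a b) = mxend (T a b) *m P) ->
  (forall a b i j, (P *m mxend (T a b)) i j
          = \sum_p (D p (mxvec_index i a))^* * D p (mxvec_index j b)) ->
  (forall p a, coef_vec D p a \in E) -> \rank D = (\rank P * n)%N ->
  positive_on T E.
Proof.
move=> oP cP DE /(coef_vec_mem D oP) DP rD.
have [PP PC rP] := orthoproj_lin oP.
pose K a b := mxend (T a b).
apply/(positive_onP _ _ e_basis) => u u0 uE.
rewrite [X in 0 < X](_ : _ = sqform (tensor_mx K) (mxvec u)); last first.
  rewrite sqform_tensor; apply: eq_bigr => i _; apply: eq_bigr => j _.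
  by apply: eq_bigr => a _; apply: eq_bigr => b _; rewrite mxE.
apply: (sqform_factor_gt0 PP PC _ (D := D)) => //.
- rewrite mul_lin_mulmx_tensor mul_tensor_lin_mulmx.
  by apply: matrix_indexP => i a j b; rewrite !tensor_mxE /K cP.
- rewrite mul_lin_mulmx_tensor; apply: matrix_indexP => i a j b.
  rewrite tensor_mxE DE mxE.
  by apply: eq_bigr => p _; rewrite !mxE.
- by rewrite rD rP.
- by rewrite -(inj_eq (can_inj vec_mxK)) mxvecK linear0.
- apply/(coef_vec_mem (mxvec u) oP) => p a; rewrite /coef_vec ord1.
  by under eq_bigr do rewrite mxvecE.
Qed.

End Curvature.
End Unitary.

(** * Unitary bases and orthogonal complements *)

Section HermitianSpaces.
Variables (C : numClosedFieldType) (V : vectType C) (g : {dot V for conjC}).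

Lemma orthonormal_tupleP r (e : r.-tuple V) :
  reflect (forall i j, g (tnth e i) (tnth e j) = (i == j)%:R)
          (orthonormal g e).
Proof.
apply: (iffP (orthonormalP (form := g))) => [[Ue He] i j|He].
  rewrite He ?mem_tnth // (inj_eq (_ : injective (tnth e))) //.
  exact/tuple_uniqP.
have inj_e : injective (tnth e).
  move=> i j eij; apply/eqP; have := He i j; rewrite eij He eqxx.
  by case: (i == j) => // /eqP; rewrite oner_eq0.
split; first exact/tuple_uniqP.
by move=> _ _ /tnthP[i ->] /tnthP[j ->]; rewrite He (inj_eq inj_e).
Qed.

(** The Gram matrix of [s] factors as the adjoint of [D] times [D]. Taking the projection to be the
    identity in [psd_factor_proj] makes [D] invertible, and the inverse of its adjoint is the change
    of basis. *)
Lemma unitary_basis_exists r (s : r.-tuple V) : basis_of fullv s ->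
  exists2 e : r.-tuple V, basis_of fullv e & orthonormal g e.
Proof.
move=> s_basis; pose H := \matrix_(i, j) g (tnth s i) (tnth s j).
pose vs (u : 'rV[C]_r) := \sum_i u 0 i *: tnth s i.
have gvs u v : g (vs u) (vs v) = (u *m H *m v^t*) 0 0.
  rewrite linear_sumr mxE; apply: eq_bigr => j _.
  rewrite linearZr_LR linear_sumlz /= !mxE mulrC; congr (_ * _).
  by apply: eq_bigr => i _; rewrite linearZl_LR !mxE.
have Hpos (u : 'rV_r) : u != 0 -> 0 < sqform H u.
  move=> u0; rewrite /sqform -gvs dnorm_gt0; apply: contraNneq u0 => vu0.
  apply/eqP/rowP => i; rewrite mxE; have /(congr1 (coord s i)) := vu0.
  by rewrite coord_sum_basis // linear0.
have [||||D [+ _ rD]] := @psd_factor_proj C r 1%:M H.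
- by rewrite mul1mx.
- by rewrite trmx1 map_mx1.
- by rewrite mul1mx mulmx1.
- by move=> u /Hpos.
rewrite mul1mx => HE; rewrite mxrank1 in rD.
have Du : D^t* \in unitmx.
  by rewrite -row_full_unit /row_full mxrank_map mxrank_tr rD.
pose X := invmx (D^t*).
have XHX : X *m H *m X^t* = 1%:M.
  rewrite HE mulmxA mulVmx // mul1mx -[D]trmxCK -trmxC_mul mulVmx //.
  by rewrite trmx1 map_mx1.
pose e := [tuple vs (row i X) | i < r].
have e_on : orthonormal g e.
  apply/orthonormal_tupleP => i j; rewrite !tnth_mktuple gvs.
  have := congr1 (fun M : 'M[C]_r => M i j) XHX; rewrite [RHS]mxE => <-.
  by rewrite -row_mul mxE [RHS]mxE; apply: eq_bigr => k _; rewrite !mxE.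
exists e => //; rewrite basisEfree (orthonormal_free e_on) subvf /=.
by rewrite (size_basis s_basis) size_map size_enum_ord.
Qed.

(** Pairing with a basis of [U] is a linear map to a space of dimension dim U whose kernel lies in
    the complement; rank-nullity then bounds the dimension of the complement from below. *)
Lemma addv_orthov (U : {vspace V}) :
  (U + orthov g U = fullv)%VS /\ directv (U + orthov g U).
Proof.
have dU : (U :&: orthov g U = 0)%VS.
  apply/eqP; rewrite -subv0; apply/subvP => v; rewrite memv_cap => /andP[vU].
  by move=> /mem_orthovP /(_ v vU)/eqP; rewrite dnorm_eq0 memv0.
split; last exact/directv_addP.
pose f : V -> 'rV[C]_(\dim U) := fun v => \row_i g v (vbasis U)`_i.
have f_lin : linear f.
  by move=> a u v; apply/rowP => i; rewrite !mxE linearDl linearZl_LR.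
pose fL := GRing.isLinear.Build _ _ _ _ f f_lin.
pose fh := linfun (HB.pack_for {linear V -> 'rV[C]_(\dim U)} f fL).
have kerf : (lker fh <= orthov g U)%VS.
  apply/subvP => v; rewrite memv_ker lfunE /= => /eqP/rowP fv0.
  apply/mem_orthovP => w /coord_vbasis ->; rewrite linear_sumr big1 // => i _.
  by rewrite linearZr_LR /=; have := fv0 i; rewrite !mxE => ->; rewrite mulr0.
apply/eqP; rewrite -dimv_leqif_eq ?subvf // eqn_leq dimvS ?subvf //=.
rewrite dimv_disjoint_sum //.
have := limg_ker_dim fh fullv; rewrite capfv => <-.
have := dimvS kerf; have := dimvS (subvf (fh @: fullv)%VS).
by rewrite dimvf /dim /= mul1n; lia.
Qed.

(** * Type II decompositions and Gram factors of the curvature *)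

Section Decomposition.
Variables (r n : nat) (T : 'I_n -> 'I_n -> 'End(V)).

Definition orth_decomposition (E1 E2 : {vspace V}) :=
  [/\ (E1 + E2 = fullv)%VS, directv (E1 + E2) & (E1 <= orthov g E2)%VS].

(* On E2 (x) T^{0,1} the form pairs v^{i bbar} with conj(v^{j abar}): the roles
   of a and b are exchanged. *)
Definition typeII_positive (E1 E2 : {vspace V}) :=
  [/\ orth_decomposition E1 E2,
      (forall a b u, u \in E1 -> T a b u \in E1),
      (forall a b u, u \in E2 -> T a b u \in E2),
      positive_on g T E1
    & positive_on g (fun a b => T b a) E2].

Variable (e : r.-tuple V).

(** The curvature identity for A and B, read on the coefficients of dz^a wedge dzbar^b. The B-term
    has a plus sign because reordering dzbar^b wedge dz^a absorbs the minus. *)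
Definition gram_factor N (DB DA : 'M[C]_(N, r * n)) :=
  forall a b i j, mxend g e (T a b) i j
    = \sum_p (DB p (mxvec_index i a))^* * DB p (mxvec_index j b)
      + \sum_p DA p (mxvec_index j a) * (DA p (mxvec_index i b))^*.

Hypothesis (e_basis : basis_of fullv e) (e_orth : orthonormal g e).
Let e_on := elimT (orthonormal_tupleP e) e_orth.

Lemma rank_compl_proj (P : 'M[C]_r) : P *m P = P ->
  (\rank P + \rank (1%:M - P)%R = r)%N.
Proof.
move=> PP; apply/eqP; rewrite eqn_leq; apply/andP; split.
  by apply: mulmx0_rank_max; rewrite mulmxBr mulmx1 PP subrr.
rewrite -{1}(mxrank1 C r) -{1}(subrKC P 1%:M); exact: mxrank_add.
Qed.

(** Each [T a b] splits as its [P]-part plus its (1 - P)-part; the first is factored by [DB], the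
    second, with [a] and [b] exchanged, by [DA]. *)
Lemma gram_factor_exists E1 E2 : typeII_positive E1 E2 ->
  exists r1 N (DB DA : 'M[C]_(N, r * n)),
    [/\ (r1 <= r)%N, gram_factor DB DA,
        (forall p a q b, g (coef_vec e DA p a) (coef_vec e DB q b) = 0),
        \rank DB = (r1 * n)%N & \rank DA = ((r - r1) * n)%N].
Proof.
case=> -[sE dE oE] T1 T2 pos1 pos2.
have [P [oP oQ]] := orthoproj_exists e_basis e_on sE dE oE.
have cP a b : P *m mxend g e (T a b) = mxend g e (T a b) *m P.
  by apply: (orthoproj_comm e_basis e_on oP oQ) => u; [apply: T1|apply: T2].
have cQ a b : (1%:M - P) *m mxend g e (T b a) = mxend g e (T b a) *m (1%:M - P).
  by rewrite mulmxBl mulmxBr mul1mx mulmx1 cP.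
have [DB [eB mB rB]] := positive_factor e_basis e_on oP cP pos1.
have [DA [eA mA rA]] := positive_factor e_basis e_on oQ cQ pos2.
have [PP _ _] := oP; have := rank_compl_proj PP => rPQ.
(* Here r1 is the dimension of [E1]; both factors are square, whence N = r n. *)
exists (\rank P), (r * n)%N, DB, DA; split=> //.
- by rewrite rank_leq_row.
- move=> a b i j; rewrite -eB; under [X in _ + X]eq_bigr do rewrite mulrC.
  rewrite -(eA b a); transitivity
    ((P *m mxend g e (T a b) + (1%:M - P) *m mxend g e (T a b)) i j).
    by rewrite -mulmxDl subrKC mul1mx.
  by rewrite [LHS]mxE.
- move=> p a q b; apply/eqP; rewrite herm_eq0C; apply/eqP.
  exact: (orthovP oE).
- by rewrite rA; congr (_ * _)%N; lia.
Qed.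

(* E2 is the span of the columns of A and E1 its orthogonal complement.  The
   ranks of B and A are at most n dim E1 and n dim E2, and add up to n r, so
   both bounds are attained; in particular this covers n = 0. *)
Lemma gram_factor_positive r1 N (DB DA : 'M[C]_(N, r * n)) :
  (r1 <= r)%N -> gram_factor DB DA ->
  (forall p a q b, g (coef_vec e DA p a) (coef_vec e DB q b) = 0) ->
  \rank DB = (r1 * n)%N -> \rank DA = ((r - r1) * n)%N ->
  exists E1 E2, typeII_positive E1 E2.
Proof.
move=> r1r eT oAB rB rA.
pose E2 := <<[seq coef_vec e DA pa.1 pa.2 | pa : 'I_N * 'I_n]>>%VS.
pose E1 := orthov g E2.
have mA p a : coef_vec e DA p a \in E2.
  by apply/memv_span/fintype.imageP; exists (p, a).
have mB p a : coef_vec e DB p a \in E1.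
  apply/mem_orthovP => v.
  have /span_subvP sE : {subset [seq coef_vec e DA pa.1 pa.2 | pa : 'I_N * 'I_n]
      <= orthov g <[coef_vec e DB p a]>}.
    move=> _ /fintype.imageP[[q b] _ ->]; rewrite mem_orthov1 /=.
    exact/eqP/oAB.
  move=> /(subvP sE); rewrite mem_orthov1 => /eqP vB; apply/eqP.
  by rewrite herm_eq0C; apply/eqP.
have [sE' dE'] := addv_orthov E2.
have sE : (E1 + E2 = fullv)%VS by rewrite addvC.
have dE : directv (E1 + E2).
  by apply/directv_addP; rewrite capvC; apply/directv_addP.
have [P [oP oQ]] := orthoproj_exists e_basis e_on sE dE (subvv _).
have [PP PC mP] := oP; have [QQ QC mQ] := oQ.
(* In coordinates, [P] fixes the vectors of [DB] and kills those of [DA]. *)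
have crdB p a i :
    \sum_k DB p (mxvec_index k a) * P k i = DB p (mxvec_index i a).
  have := mB p a; rewrite mP => /eqP/rowP/(_ i).
  rewrite (crd_coef_vec e_on) mxE => <-.
  by apply: eq_bigr => k _; rewrite (crd_coef_vec e_on).
have crdA p a i : \sum_k DA p (mxvec_index k a) * P k i = 0.
  have := mA p a; rewrite mQ mulmxBr mulmx1 => /eqP/(canRL (subKr _)).
  rewrite subrr => cA0; transitivity ((crd g e (coef_vec e DA p a) *m P) 0 i).
    rewrite mxE; apply: eq_bigr => k _; by rewrite (crd_coef_vec e_on).
  by rewrite cA0 mxE.
have conjP i k : (P k i)^* = P i k by rewrite -[in RHS]PC !mxE.
(* On the left, [P] acts on the conjugated factors through its Hermitian symmetry; only the B-sum
   survives. *)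
have PK a b i j : (P *m mxend g e (T a b)) i j
    = \sum_p (DB p (mxvec_index i a))^* * DB p (mxvec_index j b).
  rewrite mxE; under eq_bigr do rewrite eT mulrDr !mulr_sumr.
  rewrite big_split /= exchange_big [X in _ + X]exchange_big /=.
  rewrite [X in _ + X]big1 ?addr0 => [|p _].
    apply: eq_bigr => p _; rewrite -(crdB p a i) rmorph_sum mulr_suml /=.
    by apply: eq_bigr => k _; rewrite rmorphM /= conjP; ring.
  transitivity (DA p (mxvec_index j a) *
     (\sum_k DA p (mxvec_index k b) * P k i)^*);
    last by rewrite crdA conjC0 mulr0.
  rewrite rmorph_sum mulr_sumr /=.
  by apply: eq_bigr => k _; rewrite rmorphM /= conjP; ring.
(* On the right, [P] acts on the unconjugated factors and leaves the same B-sum. *)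
have KP a b : P *m mxend g e (T a b) = mxend g e (T a b) *m P.
  apply/matrixP => i j; rewrite PK mxE.
  under [RHS]eq_bigr do rewrite eT mulrDl !mulr_suml.
  rewrite big_split /= exchange_big [X in _ + X]exchange_big /=.
  rewrite [X in _ + X]big1 ?addr0 => [|p _].
    apply: eq_bigr => p _; rewrite -(crdB p b j) mulr_sumr.
    by apply: eq_bigr => k _; ring.
  transitivity ((DA p (mxvec_index i b))^* *
     (\sum_k DA p (mxvec_index k a) * P k j)); last by rewrite crdA mulr0.
  by rewrite mulr_sumr; apply: eq_bigr => k _; ring.
have KQ a b : (1%:M - P) *m mxend g e (T b a) = mxend g e (T b a) *m (1%:M - P).
  by rewrite mulmxBl mulmxBr mul1mx mulmx1 KP.
have QK a b i j : ((1%:M - P) *m mxend g e (T b a)) i j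
    = \sum_p (DA p (mxvec_index i a))^* * DA p (mxvec_index j b).
  rewrite mulmxBl mul1mx [LHS]mxE [X in _ + X]mxE PK eT addrC addKr.
  by apply: eq_bigr => p _; rewrite mulrC.
have rPQ := rank_compl_proj PP.
have [_ _ rlP] := orthoproj_lin n oP; have [_ _ rlQ] := orthoproj_lin n oQ.
have leB : (\rank DB <= \rank P * n)%N.
  by rewrite -rlP -((coef_vec_mem e_on DB oP).1 mB) mxrankS ?submxMl.
have leA : (\rank DA <= \rank (1%:M - P)%R * n)%N.
  by rewrite -rlQ -((coef_vec_mem e_on DA oQ).1 mA) mxrankS ?submxMl.
have sumr : (\rank DB + \rank DA = \rank P * n + \rank (1%:M - P)%R * n)%N.
  by rewrite rB rA -!mulnDl rPQ subnKC.
exists E1, E2; split.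
- by split=> //; apply: subvv.
- move=> a b u; rewrite !mP (crd_mxend e_basis e_on) -mulmxA -KP mulmxA.
  by move=> /eqP ->.
- move=> a b u; rewrite !mQ (crd_mxend e_basis e_on) -mulmxA -KQ mulmxA.
  by move=> /eqP ->.
- by apply: (factor_positive e_basis e_on oP KP PK mB); lia.
- by apply: (factor_positive e_basis e_on oQ KQ QK mA); lia.
Qed.

End Decomposition.
End HermitianSpaces.

(** * The Chern curvature and its (1,1)-form *)

(** A row in the kernel gives a vector orthogonal to the whole basis, hence to itself. *)
Lemma gram_unitmx (C : numClosedFieldType) (V : vectType C)
    (g : {dot V for conjC}) r (s : r.-tuple V) : basis_of fullv s ->
  \matrix_(i, j) g (tnth s i) (tnth s j) \in unitmx.
Proof.
move=> s_basis; rewrite -row_free_unit; apply/inj_row_free => u uH.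
pose v := \sum_i u 0 i *: tnth s i.
have vs j : g v (tnth s j) = 0.
  have /rowP/(_ j) := uH; rewrite !mxE => <-; rewrite linear_sumlz.
  by apply: eq_bigr => i _; rewrite linearZl_LR !mxE.
have /eqP v0 : v == 0.
  by rewrite -(dnorm_eq0 g) {2}/v linear_sumr big1 // => i _;
     rewrite linearZr_LR /= vs mulr0.
apply/rowP => i; have /(congr1 (coord s i)) := v0.
by rewrite coord_sum_basis // linear0 mxE.
Qed.

Section ChernEnd.
Variables (R : realType) (n r : nat) (X : complexManifold R n).
Variables (E : holoBundle X r) (h : hermitianMetric E).
Variables (c : chart R n X) (s : localFrame E r) (x : X).

Lemma chern_end_linear a b : linear (@chern_end R n r X E h c s x a b).
Proof.
move=> k u v; rewrite /chern_end scaler_sumr -big_split; apply: eq_bigr => i _.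
rewrite scaler_sumr -big_split; apply: eq_bigr => j _ /=.
by rewrite linearP mulrDl scalerDl scalerA mulrA.
Qed.

Definition chern_lfun a b : 'End(E x) :=
  linfun (HB.pack_for {linear E x -> E x} (chern_end h c s (x := x) a b)
    (GRing.isLinear.Build _ _ _ _ _ (chern_end_linear a b))).

Lemma chern_lfunE a b u : chern_lfun a b u = chern_end h c s a b u.
Proof. by rewrite lfunE. Qed.

Hypotheses (cx : cdom c x) (sx : fdom s x).

(** Lowering the index with the invertible Gram matrix cancels the inverse in [chern_up]; [cx]
    ensures that this matrix is the one of the metric at [x]. *)
Lemma chern_dot a b i j :
  chern h c s x a b i j = h x (chern_lfun a b (tnth (s x) i)) (tnth (s x) j).
Proof.
have s_basis := fsec_basis sx.
have gramE : gram h c s (c x)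
    = \matrix_(i, j) h x (tnth (s x) i) (tnth (s x) j).
  by apply/matrixP => k l; rewrite !mxE cmapK ?inE.
rewrite chern_lfunE /chern_end (bigD1 i) //= [X in _ + X]big1 ?addr0.
  rewrite linear_sumlz /=.
  have -> : chern h c s x a b = chern_up h c s x a b *m gram h c s (c x).
    by rewrite /chern_up -mulmxA mulVmx ?mulmx1 // gramE gram_unitmx.
  rewrite mxE; apply: eq_bigr => k _; rewrite linearZl_LR gramE !mxE /=.
  rewrite (tnth_nth 0 (s x) i) coord_free ?(basis_free s_basis) //.
  by rewrite eqxx mul1r.
move=> k ki; apply: big1 => l _.
rewrite (tnth_nth 0 (s x) i) coord_free ?(basis_free s_basis) //.
by rewrite eq_sym (negPf ki) mul0r scale0r.
Qed.

Lemma typeII_decompositionP (E1 E2 : {vspace E x}) :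
  typeII_decomposition h c s E1 E2 <-> typeII_positive (h x) chern_lfun E1 E2.
Proof.
have s_basis := fsec_basis sx.
have pos1 := positive_onP (h x) chern_lfun E1 s_basis.
have pos2 := positive_onP (h x) (fun a b => chern_lfun b a) E2 s_basis.
have eq1 (u : 'M[R[i]]_(r, n)) :
    \sum_(i < r) \sum_(j < r) \sum_(a < n) \sum_(b < n)
      chern h c s x a b i j * u i a * (u j b)^*
  = \sum_i \sum_j \sum_a \sum_b
      h x (chern_lfun a b (tnth (s x) i)) (tnth (s x) j) * u i a * (u j b)^*.
  do 4!(apply: eq_bigr => ? _); by rewrite chern_dot.
(* Exchanging the sums over [a] and [b] moves the swap of indices from [v] to the endomorphisms. *)
have eq2 (v : 'M[R[i]]_(r, n)) :
    \sum_(i < r) \sum_(j < r) \sum_(a < n) \sum_(b < n)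
      chern h c s x a b i j * v i b * (v j a)^*
  = \sum_i \sum_j \sum_a \sum_b
      h x (chern_lfun b a (tnth (s x) i)) (tnth (s x) j) * v i a * (v j b)^*.
  do 2!(apply: eq_bigr => ? _); rewrite exchange_big.
  do 2!(apply: eq_bigr => ? _); by rewrite chern_dot.
split=> -[dec T1 T2 p1 p2]; split=> //.
- by move=> a b u uE; rewrite chern_lfunE T1.
- by move=> a b u uE; rewrite chern_lfunE T2.
- by apply/pos1 => u u0 uE; rewrite -eq1; apply: p1.
- by apply/pos2 => u u0 uE; rewrite -eq2; apply: p2.
- by move=> a b u uE; rewrite -chern_lfunE T1.
- by move=> a b u uE; rewrite -chern_lfunE T2.
- by move=> u u0 uE; rewrite eq1; apply: pos1.1.
- by move=> u u0 uE; rewrite eq2; apply: pos2.1.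
Qed.

End ChernEnd.

(** * Forms of type (1,1) and their coefficient matrices *)

Section Forms11.
Variables (R : realType) (n : nat).
Local Notation C := R[i].

Definition form11 (k : 'M[C]_n) : form2 R n :=
  fun u v => \sum_a \sum_b k a b * wedge (@dz R n a) (@dzbar R n b) u v.

Definition conj_bilin (k : 'M[C]_n) (u v : 'rV[C]_n) : C :=
  \sum_a \sum_b k a b * (u 0 a * (v 0 b)^*).

Lemma form11E k u v : form11 k u v = conj_bilin k u v - conj_bilin k v u.
Proof.
rewrite /form11 /conj_bilin -sumrB; apply: eq_bigr => a _.
rewrite -sumrB; apply: eq_bigr => b _.
by rewrite /wedge /dzbar /conj_form /dz mulrBr.
Qed.

Lemma conj_bilin_delta k a b y z :
  conj_bilin k (y *: delta_mx 0 a) (z *: delta_mx 0 b) = k a b * (y * z^*).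
Proof.
rewrite /conj_bilin (bigD1 a) //= (bigD1 b) //= !mxE !eqxx !mulr1.
rewrite [X in _ + X + _]big1 ?addr0 => [|l lb]; last first.
  by rewrite !mxE (negPf lb) andbF mulr0 conjC0 !mulr0.
rewrite big1 ?addr0 // => l la; rewrite big1 // => m _.
by rewrite !mxE (negPf la) andbF mulr0 mul0r mulr0.
Qed.

(* The value at (d_a, d_b) only sees k a b - k b a, so that at (i d_a, d_b),
   which sees k a b + k b a, is needed as well. *)
Lemma form11_inj k k' : (forall u v, form11 k u v = form11 k' u v) -> k = k'.
Proof.
move=> eqk; apply/matrixP => a b.
have := eqk (1 *: delta_mx 0 a) (1 *: delta_mx 0 b).
have := eqk ('i *: delta_mx 0 a) (1 *: delta_mx 0 b).
rewrite !form11E !conj_bilin_delta conjC1 conjCi !mulr1 !mul1r => e1 e2.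
have {}e1 : k a b + k b a = k' a b + k' b a.
  apply: (mulIf (neq0Ci C)); rewrite !mulrDl.
  by move: e1; rewrite !mulrN !opprK.
apply/(mulfI (_ : 2%:R != 0 :> C)); first by rewrite pnatr_eq0.
transitivity (k a b + k b a + (k a b - k b a)); first by ring.
by rewrite e1 e2; ring.
Qed.

Variables (r N : nat) (A : 'M['rV[C]_n]_(r, N)).

Lemma wedge_ctr10 j i u v :
  wedge_ctr (fun k p => form10 (A k p)) j i u v
  = form11 (\matrix_(a, b) \sum_p A j p 0 a * (A i p 0 b)^*) u v.
Proof.
have bil w z : conj_bilin (\matrix_(a, b) \sum_p A j p 0 a * (A i p 0 b)^* ) w z
    = \sum_p form10 (A j p) w * (form10 (A i p) z)^*.
  rewrite /conj_bilin; under eq_bigr do under eq_bigr do rewrite mxE mulr_suml.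
  under eq_bigr do rewrite exchange_big.
  rewrite exchange_big; apply: eq_bigr => p _.
  rewrite /form10 mulr_suml; apply: eq_bigr => a _.
  rewrite rmorph_sum mulr_sumr; apply: eq_bigr => b _.
  by rewrite rmorphM /dz /=; ring.
by rewrite form11E !bil -sumrB.
Qed.

(** Conjugating dzbar^a gives dz^a, so each wedge comes out as dzbar^b wedge dz^a; reordering it
    produces the sign and puts the conjugated coefficient first. *)
Lemma wedge_ctr01 j i u v :
  wedge_ctr (fun k p => form01 (A k p)) j i u v
  = - form11 (\matrix_(a, b) \sum_p (A i p 0 a)^* * A j p 0 b) u v.
Proof.
have bil w z : conj_bilin (\matrix_(a, b) \sum_p (A i p 0 a)^* * A j p 0 b) w z
    = \sum_p (form01 (A i p) w)^* * form01 (A j p) z.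
  rewrite /conj_bilin; under eq_bigr do under eq_bigr do rewrite mxE mulr_suml.
  under eq_bigr do rewrite exchange_big.
  rewrite exchange_big; apply: eq_bigr => p _.
  rewrite /form01 rmorph_sum mulr_suml; apply: eq_bigr => a _.
  rewrite mulr_sumr; apply: eq_bigr => b _.
  by rewrite rmorphM /dzbar /conj_form /dz /= conjCK; ring.
rewrite form11E !bil -sumrB -sumrN; apply: eq_bigr => p _.
by rewrite /wedge /conj_form opprB [X in X - _]mulrC [X in _ - X]mulrC.
Qed.

Lemma coef_mxE p i a : coef_mx A p (mxvec_index i a) = A i p 0 a.
Proof. by rewrite mxE mxvecE mxE. Qed.

End Forms11.

(** * Matrices of forms, their spans, and the equivalence *)

Definition form_coefs (K : pzRingType) (r n N : nat) (D : 'M[K]_(N, r * n)) :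
    'M['rV[K]_n]_(r, N) :=
  \matrix_(i, p) \row_a D p (mxvec_index i a).

Lemma form_coefsK (R : realType) r n N (D : 'M[R[i]]_(N, r * n)) :
  coef_mx (form_coefs D) = D.
Proof.
apply/matrixP => p k; case/mxvec_indexP: k => i a.
by rewrite coef_mxE !mxE.
Qed.

(** Orthogonality of spans is reduced to generators one argument at a time, using the symmetry of
    [orthov]. *)
Lemma coef_span_orthoP (R : realType) (V : vectType R[i])
    (g : {dot V for conjC}) r n N (e : r.-tuple V)
    (A B : 'M['rV[R[i]]_n]_(r, N)) :
  (coef_span e A <= orthov g (coef_span e B))%VS <->
  (forall p a q b, g (coef_vec e (coef_mx A) p a)
                     (coef_vec e (coef_mx B) q b) = 0).
Proof.
have vecE (M : 'M['rV[R[i]]_n]_(r, N)) p a :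
    coef_vec e (coef_mx M) p a = \sum_(i < r) M i p 0 a *: tnth e i.
  by apply: eq_bigr => i _; rewrite coef_mxE.
split=> [oAB p a q b|oAB].
  apply: (orthovP oAB); rewrite vecE; apply/memv_span/fintype.imageP.
    by exists (p, a).
  by exists (q, b).
have oA p a : (coef_span e B <= orthov g <[coef_vec e (coef_mx A) p a]>)%VS.
  apply/span_subvP => _ /fintype.imageP[[q b] _ ->].
  rewrite mem_orthov1 /= -vecE.
  by rewrite herm_eq0C; apply/eqP/oAB.
apply/span_subvP => _ /fintype.imageP[[p a] _ ->] /=; rewrite -vecE.
by rewrite mem_orthov_sym.
Qed.

Theorem theorem5p2 (R : realType) (n r : nat) (X : complexManifold R n)
    (E : holoBundle X r) (h : hermitianMetric E) :
  strongly_decomposably_positive_II h <->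
  (forall (x : X) (c : chart R n X) (s : localFrame E r),
    holo_coordinates c -> cdom c x -> holo_frame s -> fdom s x ->
    exists (r1 : nat) (e : r.-tuple (E x)) (N : nat)
           (A B : 'M['rV[R[i]]_n]_(r, N)),
      [/\ (r1 <= r)%N /\ unitary_frame (h x) e,
          (forall (j i : 'I_r) (u v : 'rV[R[i]]_n),
             curvature_form h c s e j i u v
             = - wedge_ctr (fun k p => form01 (B k p)) j i u v
               + wedge_ctr (fun k p => form10 (A k p)) j i u v),
          (coef_span e A <= orthov (h x) (coef_span e B))%VS,
          \rank (coef_mx B) = (r1 * n)%N
        & \rank (coef_mx A) = ((r - r1) * n)%N]).
Proof.
(* Comparing coefficients turns the equation of forms into [gram_factor]; the minus sign before the
   B-term cancels the one from [wedge_ctr01]. *)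
have formula x c s (e : r.-tuple (E x)) N (A B : 'M['rV[R[i]]_n]_(r, N)) :
    unitary_frame (h x) e ->
    (forall (j i : 'I_r) (u v : 'rV[R[i]]_n),
       curvature_form h c s e j i u v
       = - wedge_ctr (fun k p => form01 (B k p)) j i u v
         + wedge_ctr (fun k p => form10 (A k p)) j i u v) <->
    gram_factor (h x) (chern_lfun h c s x) e (coef_mx B) (coef_mx A).
  move=> [e_basis /orthonormal_tupleP e_on].
  have lhs j i u v : curvature_form h c s e j i u v = form11
      (\matrix_(a, b) mxend (h x) e (chern_lfun h c s x a b) i j) u v.
    apply: eq_bigr => a _; apply: eq_bigr => b _.
    by rewrite !mxE (coord_unitary e_basis e_on) chern_lfunE.
  have rhs j i u v : - wedge_ctr (fun k p => form01 (B k p)) j i u v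
         + wedge_ctr (fun k p => form10 (A k p)) j i u v
      = form11 (\matrix_(a, b) (
           \sum_p (coef_mx B p (mxvec_index i a))^*
                   * coef_mx B p (mxvec_index j b)
         + \sum_p coef_mx A p (mxvec_index j a)
                   * (coef_mx A p (mxvec_index i b))^*)) u v.
    rewrite wedge_ctr01 wedge_ctr10 opprK /form11 -big_split.
    apply: eq_bigr => a _; rewrite -big_split; apply: eq_bigr => b _ /=.
    rewrite -mulrDl ![in LHS]mxE [in RHS]mxE; congr ((_ + _) * _).
      by apply: eq_bigr => p _; rewrite !coef_mxE.
    by apply: eq_bigr => p _; rewrite !coef_mxE.
  split=> [eqF a b i j|eqF j i u v].
    have /matrixP/(_ a b) := form11_inj (fun u v =>
      etrans (esym (lhs j i u v)) (etrans (eqF j i u v) (rhs j i u v))).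
    by rewrite [LHS]mxE [RHS]mxE.
  rewrite lhs rhs; congr (form11 _ u v); apply/matrixP => a b.
  by rewrite [LHS]mxE [RHS]mxE eqF.
split=> H x c s hc cx hs sx; have s_basis := fsec_basis sx.
  have [E1 [E2 /(typeII_decompositionP h cx sx) dec]] := H x c s hc cx hs sx.
  have [e e_basis e_on] := unitary_basis_exists (h x) s_basis.
  have [r1 [N [DB [DA [r1r eT oAB rB rA]]]]] :=
    gram_factor_exists e_basis e_on dec.
  exists r1, e, N, (form_coefs DA), (form_coefs DB).
  split; rewrite ?form_coefsK //; first by apply/formula; rewrite ?form_coefsK.
  by apply/coef_span_orthoP; rewrite !form_coefsK.
have [r1 [e [N [A [B [[r1r ue] eF /coef_span_orthoP oAB rB rA]]]]]] :=
  H x c s hc cx hs sx.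
have [E1 [E2 dec]] := gram_factor_positive ue.1 ue.2 r1r
  ((formula _ _ _ _ _ _ _ ue).1 eF) oAB rB rA.
by exists E1, E2; apply/typeII_decompositionP.
Qed.
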